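(* Let $Q=(V,A,t,h)$ be an oriented tree with $V=\{1,\dots,n\}$, let $V_1,\dots,V_n$ be finite-dimensional complex vector spaces with $p_i=\dim V_i>0$, let $([f_a],a\in A)\in\prod_{a\in A}\mathbb P(\operatorname{Hom}(V_{t(a)},V_{h(a)})^\vee)$, and let $\lambda=(\lambda_1,\dots,\lambda_n)$ be a one parameter subgroup of $\prod_{i\in V}\mathrm{SL}(V_i)$, given w.r.t. bases $v_1^i,\dots,v_{p_i}^i$ of $V_i$ by the weight vector $\underline\gamma=(\underline\gamma^1,\dots,\underline\gamma^n)$. Let $A(\lambda)$ be the set of arrows $a$ for which both $\lambda_{t(a)}$ and $\lambda_{h(a)}$ are non-trivial, and for every $a\in A(\lambda)$ fix an admissible decomposition $$(\underline\gamma^{t(a)},\underline\gamma^{h(a)})=\sum_{\substack{i(t(a))=0,\dots,p_{t(a)}-1\\ i(h(a))=0,\dots,p_{h(a)}-1}}\eta^0_{i(t(a))i(h(a))}\Bigl(\tfrac1{p_{t(a)}}\gamma^{t(a),(i(t(a)))},\tfrac1{p_{h(a)}}\gamma^{h(a),(i(h(a)))}\Bigr).$$ Then there exists a decomposition $\underline\gamma=\sum_{\underline j}\eta_{\underline j}\,\underline\gamma^{\underline j}$, over tuples $\underline j=(j_1,\dots,j_n)$ with $0\le j_i\le p_i-1$, with non-negative rational coefficients and with $\underline\gamma^{\underline j}$ basic w.r.t. $([f_a],a\in A)$ whenever $\eta_{\underline j}\ne0$, such that for every arrow $a\in A(\lambda)$, every $i(t(a))\in\{0,\dots,p_{t(a)}-1\}$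 and every $i(h(a))\in\{0,\dots,p_{h(a)}-1\}$, $$\sum_{\substack{\underline j:\ j_{t(a)}=i(t(a)),\\ j_{h(a)}=i(h(a))}}\eta_{\underline j}=\eta^0_{i(t(a))i(h(a))}.$$
   Context: A quiver has finite vertex set $V$, finite arrow set $A$, tail and head maps $t,h\colon A\to V$, and no multiple arrows; it is an oriented tree if its underlying graph is connected and $\#V=\#A+1$. For $V'\subset V$, $Q(V')$ is the full subquiver with vertex set $V'$. $\mathbb P(\operatorname{Hom}(V,W)^\vee)$ is the space of lines in $\operatorname{Hom}(V,W)$, so each $f_a\colon V_{t(a)}\to V_{h(a)}$ is nonzero; $\mathrm{SL}(V)\times\mathrm{SL}(W)$ acts by $(g,g')\cdot f=g'fg^{-1}$. A one parameter subgroup $\lambda_i$ of $\mathrm{SL}(V_i)$ is given by a basis $v_1^i,\dots,v_{p_i}^i$ and integer weights $\underline\gamma^i=(\gamma_1^i\le\dots\le\gamma_{p_i}^i)$ with sum $0$, via $\lambda_i(z)v_j^i=z^{\gamma_j^i}v_j^i$; formal one parameter subgroups allow rational weights. For $f\colon V_k\to V_l$ with $f=\sum f_{r,s}(v_r^k)^\vee\otimes v_s^l$, put $\mu([f],(\lambda_k,\lambda_l))=\max\{-\gamma_r^k+\gamma_s^l: f_{r,s}\ne0\}$ (the weight on the fibre of $\mathcal O(-1)$ over $\lim_{z\to\infty}(\lambda_k(z),\lambda_l(z))\cdot[f]$). For $0\le j\le p_i$, $V_i^{(j)}=\langle v_1^i,\dots,v_j^i\rangle$ and $\gamma^{i,(j)}=(j-p_i,\dots,j-p_i,j,\dots,j)$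 with $j-p_i$ occurring $j$ times. For $\underline j=(j_1,\dots,j_n)$ put $\underline\gamma^{\underline j}=(\tfrac1{p_1}\gamma^{1,(j_1)},\dots,\tfrac1{p_n}\gamma^{n,(j_n)})$. It is basic w.r.t. $([f_a],a\in A)$ if (1) the full subquiver $Q_{\underline j}=Q(\{i:0<j_i<p_i\})$ is connected, and for every arrow $a$ of $Q_{\underline j}$: (2) $f_a(V_{t(a)}^{(j_{t(a)})})\subset V_{h(a)}^{(j_{h(a)})}$, and (3) neither $V_{t(a)}^{(j_{t(a)})}\subset\ker f_a$ nor $V_{h(a)}^{(j_{h(a)})}\supset\operatorname{Im}f_a$. An admissible decomposition for $a\in A(\lambda)$ (such decompositions exist) is a decomposition of the displayed form with non-negative rational coefficients $\eta^0$ for which there are indices $i(t(a))_*,i(h(a))_*$ such that, writing $e=(v^{t(a)}_{i(t(a))_*})^\vee\otimes v^{h(a)}_{i(h(a))_*}$: the coefficient of $e$ in $f_a$ is nonzero; $\mu([f_a],(\lambda_{t(a)},\lambda_{h(a)}))=\mu([e],(\lambda_{t(a)},\lambda_{h(a)}))$; and whenever $\eta^0_{k\,l}\ne0$, the vector $(\tfrac1{p_{t(a)}}\gamma^{t(a),(k)},\tfrac1{p_{h(a)}}\gamma^{h(a),(l)})$ is basic w.r.t. $[f_a]$ for the quiver $t(a)\to h(a)$ and, for the formal one parameter subgroup $\lambda^{(k,l)}$ it defines, $\mu([f_a],\lambda^{(k,l)})=\mu([e],\lambda^{(k,l)})$.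
   Formalization: The final identity is proved for all pairs (i(t(a)), i(h(a))) except (0,0), where it fails as printed (e.g. 1→2→3, all V_i=C², weights (-1,1), all entries of f_a equal to 1); the coefficient at (0,0) multiplies the zero vector. *)

(* Defs.v *)
(* The complex numbers are R[i], for R : realType. *)
From HB Require Import structures.
From mathcomp Require Import all_boot all_order all_algebra.
From mathcomp Require Import complex reals.

Set Implicit Arguments.
Unset Strict Implicit.
Unset Printing Implicit Defensive.

Import Order.TTheory GRing.Theory Num.Theory.
Local Open Scope ring_scope.

Record quiver (V : finType) := Quiver {
  arrow :> finType;
  qtail : arrow -> V;
  qhead : arrow -> V;
  no_multiple_arrows : injective (fun a => (qtail a, qhead a))
}.

Section Connectedness.
Variables (V : finType) (Q : quiver V).

Definition adjacent_in (S : {set V}) : rel V := fun u v =>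
  [&& u \in S, v \in S &
   [exists a : Q, ((qtail a == u) && (qhead a == v))
               || ((qtail a == v) && (qhead a == u))]].

(* Convention: the full subquiver on the empty vertex set is connected. *)
Definition full_subquiver_connected (S : {set V}) : Prop :=
  forall u v, u \in S -> v \in S -> connect (adjacent_in S) u v.

Definition oriented_tree : Prop :=
  full_subquiver_connected [set: V] /\ #|V| = #|Q|.+1.

End Connectedness.

Section OneParameterSubgroups.
Variables (K : fieldType) (E : vectType K).

(* A one parameter subgroup of SL(E) presented by a basis of E and by
   nondecreasing integer weights with sum zero. *)
Record one_ps := OnePS {
  ops_basis : (\dim {:E}).-tuple E;
  ops_wt : 'rV[int]_(\dim {:E});
  ops_basisP : basis_of fullv ops_basis;
  ops_sorted : forall r s : 'I_(\dim {:E}),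
    (r <= s)%N -> ops_wt ord0 r <= ops_wt ord0 s;
  ops_sum0 : \sum_r ops_wt ord0 r = 0
}.

Definition ops_act (lam : one_ps) (z : K) : 'End(E) :=
  linfun (fun v : E => \sum_r (z ^ (ops_wt lam ord0 r)
            * coord (ops_basis lam) r v) *: (ops_basis lam)`_r).

Definition ops_nontrivial (lam : one_ps) : Prop :=
  exists2 z : K, z != 0 & ops_act lam z <> \1%VF.

Definition ops_ratwt (lam : one_ps) : 'rV[rat]_(\dim {:E}) :=
  map_mx intr (ops_wt lam).

End OneParameterSubgroups.

(* The vector 1/p * gamma^{(j)}.  It is zero for j = 0. *)
Definition gam (p j : nat) : 'rV[rat]_p :=
  p%:R^-1 *: \row_(k < p) (if (k < j)%N then j%:R - p%:R else j%:R).

Definition flag (K : fieldType) (E : vectType K) (b : seq E) (j : nat)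
  : {vspace E} := <<take j b>>%VS.

Section Mu.
Variables (K : fieldType) (E E' : vectType K).
Variables (b : (\dim {:E}).-tuple E) (b' : (\dim {:E'}).-tuple E').

(* The coefficient f_{r,s} of (v_r)^vee (x) v'_s in f. *)
Definition hom_coef (f : 'Hom(E, E')) (r : 'I_(\dim {:E}))
  (s : 'I_(\dim {:E'})) : K := coord b' s (f b`_r).

(* The map (v_r)^vee (x) v'_s. *)
Definition elem_hom (r : 'I_(\dim {:E})) (s : 'I_(\dim {:E'})) : 'Hom(E, E') :=
  linfun (fun v : E => coord b r v *: b'`_s).

(* The list is nonempty for f != 0; for f = 0 the value is the junk value 0. *)
Definition mu (f : 'Hom(E, E')) (g : 'rV[rat]_(\dim {:E}))
    (g' : 'rV[rat]_(\dim {:E'})) : rat :=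
  let wts := [seq - g ord0 rs.1 + g' ord0 rs.2 |
               rs <- enum {: 'I_(\dim {:E}) * 'I_(\dim {:E'})}
               & hom_coef f rs.1 rs.2 != 0] in
  \big[Num.max/wts`_0]_(x <- wts) x.

End Mu.

Section Basic.
Variables (K : fieldType) (V : finType) (Q : quiver V) (E : V -> vectType K).
Variables (b : forall v, seq (E v)).
Variables (f : forall a : Q, 'Hom(E (qtail a), E (qhead a))).

Definition jsupp (j : V -> nat) : {set V} :=
  [set v | (0 < j v < \dim {:E v})%N].

Definition basic (j : V -> nat) : Prop :=
  full_subquiver_connected Q (jsupp j) /\
  forall a : Q, qtail a \in jsupp j -> qhead a \in jsupp j ->
    let Ft := flag (b (qtail a)) (j (qtail a)) in
    let Fh := flag (b (qhead a)) (j (qhead a)) in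
    [/\ (f a @: Ft <= Fh)%VS,
        ~~ (Ft <= lker (f a))%VS &
        ~~ (limg (f a) <= Fh)%VS].

End Basic.

(* The quiver with two vertices and one arrow, from false to true. *)
Lemma one_arrow_inj : injective (fun _ : unit => (false, true)).
Proof. by case=> [] []. Qed.

Definition one_arrow_quiver : quiver bool :=
  @Quiver bool unit (fun _ => false) (fun _ => true) one_arrow_inj.

Section SingleArrow.
Variables (K : fieldType) (E E' : vectType K).

Definition pair_space (c : bool) : vectType K := if c then E' else E.

Definition pair_basis (b : seq E) (b' : seq E') (c : bool)
  : seq (pair_space c) :=
  if c as c0 return seq (pair_space c0) then b' else b.

Definition basic_pair (b : seq E) (b' : seq E') (f : 'Hom(E, E'))
    (k l : nat) : Prop :=
  @basic K bool one_arrow_quiver pair_space (pair_basis b b') (fun _ => f)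
    (fun c => if c then l else k).

Definition admissible_decomposition (lam : one_ps E) (lam' : one_ps E')
    (f : 'Hom(E, E'))
    (eta : 'I_(\dim {:E}) -> 'I_(\dim {:E'}) -> rat) : Prop :=
  let b := ops_basis lam in
  let b' := ops_basis lam' in
  [/\ forall k l, 0 <= eta k l,
      ops_ratwt lam = \sum_k \sum_l eta k l *: gam (\dim {:E}) k,
      ops_ratwt lam' = \sum_k \sum_l eta k l *: gam (\dim {:E'}) l &
      exists r s,
        let e := elem_hom b b' r s in
        [/\ hom_coef b b' f r s != 0,
            mu b b' f (ops_ratwt lam) (ops_ratwt lam')
              = mu b b' e (ops_ratwt lam) (ops_ratwt lam') &
            forall k l, eta k l != 0 ->
              basic_pair b b' f k l /\
              mu b b' f (gam (\dim {:E}) k) (gam (\dim {:E'}) l)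
                = mu b b' e (gam (\dim {:E}) k) (gam (\dim {:E'}) l)]].

End SingleArrow.

(* Membership of a in A(lambda). *)
Definition active_arrow (K : fieldType) (V : finType) (Q : quiver V)
    (E : V -> vectType K) (lam : forall v, one_ps (E v)) (a : Q) : Prop :=
  ops_nontrivial (lam (qtail a)) /\ ops_nontrivial (lam (qhead a)).

(* Main.v *)
Require Import Defs.
From HB Require Import structures.
From mathcomp Require Import all_boot all_order all_algebra.
From mathcomp Require Import complex reals boolp ring lra.
Import Order.TTheory GRing.Theory Num.Theory.
Local Open Scope ring_scope.

(** Up to the zero vector [gam p 0], the vectors [gam p k] form a basis of the
    weight vectors with sum zero, and the coefficient of [gam p k] is the jump
    of the weights from position [k - 1] to position [k]
    ([jump_gam_sum], [gam_expansion]).  Hence an admissible decomposition for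
    an arrow is a coupling: a nonnegative matrix whose row and column sums,
    away from index 0, are the jumps at the tail and at the head.  What is
    asked for is a nonnegative measure on tuples [j] that has all these
    matrices as its two-dimensional marginals and that charges only basic
    tuples.

    On a tree, such a measure is obtained by gluing the couplings along the
    arrows, one vertex at a time ([tree_gluing]).  When a vertex [v] is attached
    to an old vertex [u], a tuple with [j u = k <> 0] is prolonged by [l] with
    conditional probability [w k l / c k], as in a Markov chain; a tuple with
    [j u = 0] is prolonged by 0 only, and the remaining masses [w 0 l] go to
    the tuples that are supported at [v] alone.  The state 0 is thus absorbing in
    every direction, which keeps supports connected.  Every step consumes one
    new vertex and one new arrow, so [#V = #A + 1] forces all arrows to have been
    used when the vertices are exhausted, and no discussion of cycles is needed.

    Finally, let [j] have positive mass.  Its support is connected.  If an arrow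
    has both ends in the support, its coupling charges a pair of nonzero indices,
    so the arrow is active, and the two remaining conditions of basicness are
    those of the admissible decomposition.  At an inactive arrow the masses can
    be put on the two axes ([axial_coupling]), so that no tuple of positive mass
    has such an arrow in its support. *)

Set Implicit Arguments.
Unset Strict Implicit.

(** * Gluing couplings along a tree *)

Section Gluing.

Variables (F : numFieldType) (V : finType) (Q : quiver V).
Variables (T : V -> finType) (o : forall i, T i).

Notation config := {dffun forall i : V, T i}.

Definition csupp (j : config) : {set V} := [set i | j i != o i].

Definition rest : config := [ffun i : V => o i].

Definition update (j : config) (v : V) (x : T v) : config :=
  [ffun i : V => dfwith j x i].

Lemma update_in j v (x : T v) : update j x v = x.
Proof. by rewrite ffunE dfwith_in. Qed.

Lemma update_out j v (x : T v) i : i != v -> update j x i = j i.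
Proof. by move=> iv; rewrite ffunE dfwith_out // eq_sym. Qed.

Lemma update_same j v : update j (j v) = j.
Proof.
apply/ffunP => i; case: (eqVneq i v) => [->|/update_out->//].
by rewrite update_in.
Qed.

Lemma update_update j v (x y : T v) : update (update j x) y = update j y.
Proof.
apply/ffunP => i; case: (eqVneq i v) => [->|iv]; first by rewrite !update_in.
by rewrite !update_out.
Qed.

Lemma sum_update v (P : pred config) (G : config -> F) :
  \sum_(j | P j) G j =
  \sum_(j : config | j v == o v) \sum_(x : T v | P (update j x)) G (update j x).
Proof.
rewrite (partition_big (fun j => update j (o v)) (fun j => j v == o v)) /=;
  last by move=> j _; rewrite update_in.
apply: eq_bigr => j /eqP jv.
rewrite (reindex_onto (@update j v) (fun j' => j' v)) /=; last first.
  by move=> i /andP[_ /eqP<-]; rewrite update_update update_same.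
apply: eq_bigl => x.
by rewrite update_update -jv update_same eqxx update_in eqxx !andbT.
Qed.

(** The sums along the indices [o u] and [o v] are left free: those indices
    stand for the zero vector of weights, whose coefficient is arbitrary. *)
Definition coupling u v (cu : T u -> F) (cv : T v -> F) (w : T u -> T v -> F) :=
  [/\ forall k l, 0 <= w k l,
      forall k, k != o u -> \sum_l w k l = cu k &
      forall l, l != o v -> \sum_k w k l = cv l].

Lemma coupling_sym u v cu cv (w : T u -> T v -> F) :
  coupling cu cv w -> coupling cv cu (fun l k => w k l).
Proof. by case. Qed.

Lemma coupling_eq0 u v cu cv (w : T u -> T v -> F) k l :
  coupling cu cv w -> k != o u -> cu k = 0 -> w k l = 0.
Proof.
case=> w0 wu _ ko ck; have := wu _ ko; rewrite ck => /psumr_eq0P-> //.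
Qed.

Variable c : forall i, T i -> F.

(** The state of the construction once the vertices of [S] have been attached
    along the arrows of [B].  The marginals along the arrows of [B] are carried
    separately, because the coupling of a new arrow may have to be transposed
    before it is used in a step. *)
Record gluing (S : {set V}) (B : {set Q}) (eta : config -> F) : Prop := Gluing {
  glue_ge0 : forall j, 0 <= eta j;
  glue_supp : forall j, eta j != 0 ->
    csupp j \subset S /\ full_subquiver_connected Q (csupp j);
  glue_vertex : forall i, i \in S -> forall k, k != o i ->
    \sum_(j : config | j i == k) eta j = c k;
  glue_ends : forall a, a \in B -> (qtail a \in S) && (qhead a \in S)
}.

Definition pair_marginal (eta : config -> F) u v (w : T u -> T v -> F) :=
  forall k l, (k != o u) || (l != o v) ->
    \sum_(j : config | (j u == k) && (j v == l)) eta j = w k l.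

(** The Markov prolongation of [eta] to a new vertex [v], attached to [u] by the
    coupling [w].  If [c (j u)] vanishes, then so does [eta] there, and the
    value [0] of the quotient is the right one. *)
Definition extension (eta : config -> F) u v (w : T u -> T v -> F)
    (j : config) : F :=
  if j u != o u then eta (update j (o v)) * w (j u) (j v) / c (j u)
  else if j v == o v then eta j
  else if csupp j == [set v] then w (o u) (j v) else 0.

Section Step.

Variables (S : {set V}) (B : {set Q}) (eta : config -> F) (u v : V).
Variable w : T u -> T v -> F.
Hypotheses (etaP : gluing S B eta) (uS : u \in S) (vS : v \notin S).
Hypotheses (uv : adjacent_in Q [set: V] u v) (wP : coupling (@c u) (@c v) w).

Let neq_uv : u != v. Proof. by apply: contraNneq vS => <-. Qed.
Let w_ge0 k l : 0 <= w k l. Proof. by case: wP. Qed.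
Let c_ge0 k : k != o u -> 0 <= c k.
Proof.
move=> ko; rewrite -(glue_vertex etaP uS ko) sumr_ge0 // => j _.
exact: glue_ge0 etaP j.
Qed.

Let eta_new (j : config) : j v != o v -> eta j = 0.
Proof.
move=> jv; apply/eqP; apply: contraT => /(glue_supp etaP)[/subsetP/(_ v)].
by rewrite inE jv (negPf vS) => /(_ isT).
Qed.

Let eta_eq0 (j : config) : j u != o u -> c (j u) = 0 -> eta j = 0.
Proof.
move=> ju cj; have := glue_vertex etaP uS ju; rewrite cj => sum0.
by apply: (psumr_eq0P _ sum0) => // i _; apply: glue_ge0 etaP i.
Qed.

Lemma extension_ge0 j : 0 <= extension eta w j.
Proof.
rewrite /extension; case: ifP => [ju|_].
  by rewrite divr_ge0 ?mulr_ge0 ?(glue_ge0 etaP) ?w_ge0 ?c_ge0.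
by case: ifP => _; [exact: glue_ge0 etaP _ | case: ifP].
Qed.

Lemma csupp_update (j : config) (x : T v) :
  j v = o v -> x != o v -> csupp (update j x) = v |: csupp j.
Proof.
move=> jv xo; apply/setP => i; rewrite !inE.
by case: (eqVneq i v) => [->|/update_out-> //]; rewrite update_in xo.
Qed.

Lemma csupp_eq0 j : (csupp j == set0) = (j == rest).
Proof.
apply/eqP/eqP => [j0|->]; last by apply/setP => i; rewrite !inE ffunE eqxx.
apply/ffunP => i; rewrite ffunE; apply/eqP; apply: contraT => ji.
by have: i \in csupp j by [rewrite inE]; rewrite j0 inE.
Qed.

(** The form in which [extension] is summed: by [sum_update], a sum over all
    tuples runs over the tuples that rest at [v] and over the index at [v]. *)
Lemma extension_update (j : config) (x : T v) : j v = o v ->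
  extension eta w (update j x) =
  if j u != o u then eta j * w (j u) x / c (j u)
  else if x == o v then eta j else if j == rest then w (o u) x else 0.
Proof.
move=> jv; have jo : update j (o v) = j by rewrite -jv update_same.
rewrite /extension update_update update_in jo.
rewrite (update_out _ _ neq_uv); case: ifP => // _.
case: (eqVneq x (o v)) => [->|xo]; first by rewrite jo.
rewrite csupp_update // -csupp_eq0; congr (if _ then _ else _).
have vj : v \notin csupp j by rewrite inE jv eqxx.
apply/eqP/eqP => [e|->]; last by rewrite setU0.
by rewrite -(setU1K vj) e setDv.
Qed.

(** The row sums of [w] make prolongation preserve the mass of every old tuple
    other than [rest], which receives the mass of the tuples supported at [v]. *)
Lemma sum_extension_update (j : config) : j v = o v -> j != rest ->
  \sum_(x : T v) extension eta w (update j x) = eta j.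
Proof.
move=> jv jr; have [ju|ju] := boolP (j u != o u).
  transitivity (\sum_(x : T v) eta j * w (j u) x / c (j u)).
    by apply: eq_bigr => x _; rewrite extension_update // ju.
  rewrite -mulr_suml -mulr_sumr; case: wP => _ -> // _.
  have [cj|cj] := eqVneq (c (j u)) 0; last by rewrite mulfK.
  by rewrite eta_eq0 ?mul0r.
rewrite (bigD1 (o v)) //= extension_update // (negPf ju) eqxx.
rewrite big1 ?addr0 // => x xo.
by rewrite extension_update // (negPf ju) (negPf xo) (negPf jr).
Qed.

(** Every marginal of [eta] on the old vertices survives, except at [rest]. *)
Lemma sum_extension (P : pred config) :
  (forall j (x : T v), P (update j x) = P j) -> ~~ P rest ->
  \sum_(j | P j) extension eta w j = \sum_(j | P j) eta j.
Proof.
move=> Pv Pr; rewrite (sum_update v).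
rewrite (bigID (fun j : config => j v == o v) P) /=.
rewrite [X in _ = _ + X]big1 ?addr0; last by move=> j /andP[_ /eta_new].
rewrite [RHS]big_mkcondl /=; apply: eq_bigr => j /eqP jv.
rewrite (eq_bigl (fun=> P j)) => [|x]; last exact: Pv.
case: ifP => Pj; last by rewrite big_pred0.
by apply: sum_extension_update => //; apply: contraNneq Pr => <-.
Qed.

Lemma extension_marginal (u' v' : V) (w' : T u' -> T v' -> F) :
  u' \in S -> v' \in S -> pair_marginal eta w' ->
  pair_marginal (extension eta w) w'.
Proof.
move=> u'S v'S etaw k l kl; rewrite -etaw //; apply: sum_extension => [j x|].
  by rewrite !update_out //; apply: contraNneq vS => <-.
by rewrite !ffunE negb_and ![o _ == _]eq_sym.
Qed.

Lemma extension_new_marginal : pair_marginal (extension eta w) w.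
Proof.
move=> k l kl; rewrite (sum_update v) /=.
have [ko|ko] := boolP (k == o u); last first.
  transitivity (\sum_(j : config | j u == k) eta j * (w k l / c k)).
    rewrite (bigID (fun j : config => j v == o v) (fun j => j u == k)) /=.
    rewrite [X in _ = _ + X]big1 ?addr0; last first.
      by move=> j /andP[_ /eta_new->]; rewrite mul0r.
    rewrite [RHS]big_mkcondl /=; apply: eq_bigr => j /eqP jv.
    under eq_bigl => x do rewrite update_in (update_out _ _ neq_uv).
    case: eqP => [ju|_]; last by rewrite big_pred0.
    by rewrite /= big_pred1_eq extension_update // ju ko mulrA.
  rewrite -mulr_suml (glue_vertex etaP) //.
  have [ck|ck] := eqVneq (c k) 0; last by rewrite mulrC divfK.
  by rewrite ck mul0r (coupling_eq0 _ wP).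
(* Now k is the rest index, and rest is the only old tuple with j u = k whose
   prolongations charge l. *)
have lo : l != o v by rewrite ko in kl.
rewrite (eqP ko) (bigD1 rest) /=; last by rewrite ffunE.
rewrite [X in _ + X]big1 ?addr0 => [|j /andP[/eqP jv jr]].
  under eq_bigl => x do rewrite update_in (update_out _ _ neq_uv) ffunE eqxx.
  by rewrite big_pred1_eq extension_update ffunE // !eqxx (negPf lo).
under eq_bigl => x do rewrite update_in (update_out _ _ neq_uv).
rewrite big1 // => x /andP[ju /eqP->].
by rewrite extension_update // ju (negPf lo) (negPf jr).
Qed.

Lemma connected_add1 (X : {set V}) : u \in X ->
  full_subquiver_connected Q X -> full_subquiver_connected Q (v |: X).
Proof.
move=> uX cX.
have sym : symmetric (adjacent_in Q (v |: X)).
  move=> x y; rewrite /adjacent_in andbCA; do 2 congr (_ && _).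
  by apply: eq_existsb => a; rewrite orbC.
have csym := sym_connect_sym sym.
have to_u x : x \in v |: X -> connect (adjacent_in Q (v |: X)) u x.
  case/setU1P => [->|xX].
    apply: connect1; case/and3P: uv => _ _ e.
    by rewrite /adjacent_in !inE eqxx uX orbT.
  apply: connect_sub (cX _ _ uX xX) => y z /and3P[yX zX e]; apply: connect1.
  by rewrite /adjacent_in !inE yX zX !orbT.
by move=> x y /to_u ux /to_u uy; rewrite csym in ux; apply: connect_trans uy.
Qed.

Lemma extension_supp j : extension eta w j != 0 ->
  csupp j \subset v |: S /\ full_subquiver_connected Q (csupp j).
Proof.
have oldP i : eta i != 0 ->
    csupp i \subset v |: S /\ full_subquiver_connected Q (csupp i).
  case/(glue_supp etaP) => iS ic; split=> //.
  by apply: subset_trans iS _; apply: subsetUr.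
rewrite /extension; case: ifP => [ju|_].
  rewrite !mulf_eq0 !negb_or -andbA => /and3P[ej _ _].
  have [js jc] := oldP _ ej.
  have [jv|jv] := eqVneq (j v) (o v); first by rewrite -jv update_same in js jc.
  have -> : csupp j = v |: csupp (update j (o v)).
    apply/setP => i; rewrite !inE.
    by case: (eqVneq i v) => [->|/update_out-> //]; rewrite jv.
  split; first by rewrite subUset sub1set setU11.
  by apply: connected_add1 => //; rewrite inE update_out.
case: ifP => _; first exact: oldP.
case: ifP => [/eqP-> _|]; last by rewrite eqxx.
split; first by rewrite sub1set setU11.
by move=> x y /set1P-> /set1P->.
Qed.

Lemma extension_gluing (a : Q) :
  (qtail a \in v |: S) && (qhead a \in v |: S) ->
  gluing (v |: S) (a |: B) (extension eta w).
Proof.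
move=> aS; split.
- exact: extension_ge0.
- exact: extension_supp.
- move=> i /setU1P[->|iS] k ko.
    rewrite (partition_big (fun j : config => j u) xpredT) //=.
    case: (wP) => _ _ <- //; apply: eq_bigr => l _.
    rewrite -extension_new_marginal ?ko ?orbT //.
    by apply: eq_bigl => j; rewrite andbC.
  rewrite -(glue_vertex etaP iS ko); apply: sum_extension => [j x|].
    by rewrite update_out //; apply: contraNneq vS => <-.
  by rewrite ffunE eq_sym.
- move=> e /setU1P[->//|/(glue_ends etaP)/andP[tS hS]].
  by rewrite !inE tS hS !orbT.
Qed.

End Step.

Lemma exists_crossing_arrow (S : {set V}) u v :
  full_subquiver_connected Q [set: V] -> u \in S -> v \notin S ->
  exists a : Q, (qtail a \in S) != (qhead a \in S).
Proof.
move=> conn uS vS; apply/existsP; apply: contraR vS => noarrow.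
have closedS : closed (adjacent_in Q [set: V]) (mem S).
  move=> x y /and3P[_ _ /existsP[a xy]]; apply/eqP.
  apply: contraR noarrow => xyS; apply/existsP; exists a.
  by case/orP: xy => /andP[/eqP-> /eqP->] //; rewrite eq_sym.
by rewrite -(closed_connect closedS (conn u v _ _)) ?inE.
Qed.

(** Couplings with matching marginals along the arrows of a tree are the
    two-dimensional marginals of one measure with connected supports.  The
    induction carries [#S = #B + 1], so that [B] contains all arrows as soon as
    [S] contains all vertices. *)
Theorem tree_gluing (q : forall a : Q, T (qtail a) -> T (qhead a) -> F) :
  oriented_tree Q ->
  (forall i k, k != o i -> 0 <= c k) ->
  (forall a, coupling (@c (qtail a)) (@c (qhead a)) (q a)) ->
  exists eta : config -> F,
  [/\ forall j, 0 <= eta j,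
      forall j, eta j != 0 -> full_subquiver_connected Q (csupp j),
      forall i k, k != o i -> \sum_(j : config | j i == k) eta j = c k &
      forall a, pair_marginal eta (q a)].
Proof.
move=> [conn card_tree] c_ge0 qP.
suff [eta etaP marg] : exists2 eta, gluing [set: V] [set: Q] eta
    & forall a, a \in [set: Q] -> pair_marginal eta (q a).
  exists eta; split=> [||i k|a].
  - exact: glue_ge0 etaP.
  - by move=> j /(glue_supp etaP)[].
  - by apply: (glue_vertex etaP); rewrite inE.
  - by apply: marg; rewrite inE.
have grow m : (m < #|V|)%N -> exists S : {set V}, exists B : {set Q},
    [/\ #|S| = m.+1, #|B| = m & exists2 eta, gluing S B eta
    & forall a, a \in B -> pair_marginal eta (q a)].
  elim: m => [V_gt0|m IHm ltmV].
    have [r _] := card_gt0P V_gt0.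
    exists [set r], set0; rewrite cards1 cards0; split=> //.
    (* A single vertex r: the index k is carried by the tuple that is k at r
       and at rest elsewhere. *)
    pose eta (j : config) : F := if csupp j == [set r] then c (j r) else 0.
    exists eta => [|a]; last by rewrite inE.
    split=> [j|j|i /set1P-> k ko|a]; last by rewrite in_set0.
    - rewrite /eta; case: eqP => // jr; apply: c_ge0.
      by have := set11 r; rewrite -jr inE.
    - rewrite /eta; case: (csupp j =P _) => [->|_]; rewrite ?eqxx // => _.
      split=> //.
      by move=> x y /set1P-> /set1P->.
    rewrite (bigD1 (update rest k)) ?update_in //= big1 ?addr0 => [|j].
      rewrite /eta update_in; case: eqP => // [[]]; apply/setP => x.
      rewrite !inE; case: (eqVneq x r) => [->|xr]; first by rewrite update_in.
      by rewrite update_out // ffunE eqxx.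
    case/andP=> /eqP jr; rewrite /eta; case: (csupp j =P _) => // sj; case/eqP.
    apply/ffunP => x; case: (eqVneq x r) => [->|xr]; first by rewrite update_in.
    rewrite update_out // ffunE; apply/eqP; apply: contraTT xr => ji.
    by rewrite negbK -in_set1 -sj inE.
  have [S [B [cS cB [eta etaP marg]]]] := IHm (ltnW ltmV).
  have [u uS] : exists u, u \in S by apply/card_gt0P; rewrite cS.
  have [v vS] : exists v, v \notin S.
    have: (0 < #|~: S|)%N by rewrite cardsCs setCK cS subn_gt0.
    by case/card_gt0P=> v; rewrite inE; exists v.
  have [a tha] := exists_crossing_arrow conn uS vS.
  have aB : a \notin B.
    by apply: contraNN tha => /(glue_ends etaP)/andP[-> ->].
  have adj : adjacent_in Q [set: V] (qtail a) (qhead a).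
    by rewrite /adjacent_in !inE; apply/existsP; exists a; rewrite !eqxx.
  have [tS|tS] := boolP (qtail a \in S).
  - have hS : qhead a \notin S by rewrite tS in tha.
    exists (qhead a |: S), (a |: B); rewrite !cardsU1 hS aB cS cB; split=> //.
    exists (extension eta (q a)).
      by apply: extension_gluing; rewrite // !inE tS eqxx orbT.
    move=> e /setU1P[->|eB].
      exact: extension_new_marginal etaP tS hS (qP a).
    have /andP[etS ehS] := glue_ends etaP eB.
    exact: extension_marginal etaP tS hS (qP a) _ _ _ etS ehS (marg e eB).
  - have hS : qhead a \in S by move: tha; rewrite (negPf tS); case: (_ \in S).
    have qP' := coupling_sym (qP a).
    have adj' : adjacent_in Q [set: V] (qhead a) (qtail a).
      by rewrite /adjacent_in !inE; apply/existsP; exists a; rewrite !eqxx orbT.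
    exists (qtail a |: S), (a |: B); rewrite !cardsU1 tS aB cS cB; split=> //.
    exists (extension eta (fun l k => q a k l)).
      by apply: extension_gluing; rewrite // !inE hS eqxx orbT.
    move=> e /setU1P[->|eB].
      move=> k l kl; rewrite -(extension_new_marginal etaP hS tS qP') 1?orbC //.
      by apply: eq_bigl => j; rewrite andbC.
    have /andP[etS ehS] := glue_ends etaP eB.
    exact: extension_marginal etaP hS tS qP' _ _ _ etS ehS (marg e eB).
have [|S [B [cS cB [eta etaP marg]]]] := grow #|Q|; first by rewrite card_tree.
have ST : S = [set: V].
  by apply/eqP; rewrite eqEcard subsetT cardsT cS card_tree /=.
have BT : B = [set: Q] by apply/eqP; rewrite eqEcard subsetT cardsT cB /=.
by exists eta; rewrite -?ST -?BT.
Qed.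

End Gluing.

(** * Expansion of a weight vector in the flag weights *)

Section FlagWeights.

Variable p : nat.
Implicit Types (x y : 'rV[rat]_p) (k : 'I_p).

(** Truncated at 0, so that [jump x k] is meaningful for [0 < k] only. *)
Definition prev_ord k : 'I_p :=
  Ordinal (leq_ltn_trans (leq_pred k) (ltn_ord k)).

Definition jump x k : rat := x ord0 k - x ord0 (prev_ord k).

Lemma gamE (j : nat) k : gam p j ord0 k = j%:R / p%:R - (k < j)%N%:R.
Proof.
have p_neq0 : p%:R != 0 :> rat.
  by rewrite pnatr_eq0 -lt0n (leq_ltn_trans _ (ltn_ord k)).
by rewrite !mxE; case: ifP => _; rewrite mulrC ?subr0 // mulrBl divff.
Qed.

Lemma sum_gam (j : 'I_p) : \sum_k gam p j ord0 k = 0.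
Proof.
have p_neq0 : p%:R != 0 :> rat.
  by rewrite pnatr_eq0 -lt0n (leq_ltn_trans _ (ltn_ord j)).
under eq_bigr => k _ do rewrite gamE.
rewrite sumrB sumr_const card_ord -[_ *+ p]mulr_natr divfK //.
rewrite -natr_sum -big_mkcond /=.
rewrite -(big_ord_widen _ (fun=> 1%N) (ltnW (ltn_ord j))).
by rewrite sum_nat_const card_ord muln1 subrr.
Qed.

Lemma jump_gam (j : nat) k : (0 < k)%N -> jump (gam p j) k = (j == k)%:R.
Proof.
move=> k0; rewrite /jump !gamE /=.
by rewrite prednK //; case: ltngtP => _ /=; ring.
Qed.

Lemma jump_sum (I : finType) (a : I -> rat) (g : I -> 'rV[rat]_p) k :
  jump (\sum_i a i *: g i) k = \sum_i a i * jump (g i) k.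
Proof.
rewrite /jump !summxE -sumrB; apply: eq_bigr => i _.
by rewrite !mxE mulrBr.
Qed.

Lemma jump_gam_sum (a : 'I_p -> rat) k : (0 < k)%N ->
  jump (\sum_(j < p) a j *: gam p j) k = a k.
Proof.
move=> k0; rewrite jump_sum (bigD1 k) //= jump_gam // eqxx mulr1.
rewrite big1 ?addr0 // => j jk.
by rewrite jump_gam // (negPf (_ : (j : nat) != k)) ?mulr0.
Qed.

(** Both sides have the same jumps, hence differ by a constant vector, which has
    sum zero.  The coefficient at 0 is arbitrary because [gam p 0 = 0]. *)
Lemma gam_expansion x (a : 'I_p -> rat) : \sum_k x ord0 k = 0 ->
  (forall k, (0 < k)%N -> a k = jump x k) -> x = \sum_(j < p) a j *: gam p j.
Proof.
move=> x0 ax; set y := \sum_(j < p) _.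
have y0 : \sum_k y ord0 k = 0.
  under eq_bigr => k _ do rewrite summxE.
  rewrite exchange_big big1 //= => j _.
  under eq_bigr => k _ do rewrite mxE.
  by rewrite -mulr_sumr sum_gam mulr0.
have const k (l : 'I_p) : (k <= l)%N -> (x - y) ord0 k = (x - y) ord0 l.
  case: l => m; elim: m => [|m IHm] lt_m kl.
    by congr (_ _ _); apply: val_inj => /=; apply/eqP; rewrite -leqn0.
  case: (ltngtP k m.+1) kl => // [km _|km _];
    last by congr (_ _ _); apply: val_inj.
  rewrite (IHm (ltnW lt_m)) //.
  have := @jump_gam_sum a (Ordinal lt_m) isT; rewrite ax // /jump -/y.
  have -> : prev_ord (Ordinal lt_m) = Ordinal (ltnW lt_m) by apply: val_inj.
  by rewrite !mxE; lra.
apply/rowP => k; apply/eqP; rewrite -subr_eq0.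
have cst l : (x - y) ord0 l = (x - y) ord0 k.
  by case: (leqP k l) => [/const->|/ltnW/const->].
have : \sum_l (x - y) ord0 l = 0.
  under eq_bigr => l _ do rewrite !mxE.
  by rewrite sumrB x0 y0 subrr.
under eq_bigr => l _ do rewrite cst.
rewrite sumr_const card_ord => /eqP; rewrite mulrn_eq0 !mxE.
by case/orP => // /eqP p0; have := ltn_ord k; rewrite [X in (_ < X)%N]p0.
Qed.

End FlagWeights.

(** * Couplings attached to the arrows, and the theorem *)

(** Any two prescriptions are coupled by a matrix that is supported on the two
    axes; it never makes both indices leave [o] together. *)
Lemma axial_coupling (F : numFieldType) (V : finType) (T : V -> finType)
    (o : forall i, T i) u v (cu : T u -> F) (cv : T v -> F) :
  (forall k, k != o u -> 0 <= cu k) -> (forall l, l != o v -> 0 <= cv l) ->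
  coupling o cu cv (fun k l => if k != o u then (if l == o v then cu k else 0)
                               else if l == o v then 0 else cv l).
Proof.
move=> cu0 cv0; split=> [k l|k ko|l lo].
- by case: ifP => [/cu0|_]; case: ifP => // /negbT/cv0.
- by under eq_bigr => l _ do rewrite ko; rewrite -big_mkcond /= big_pred1_eq.
- by rewrite (bigD1 (o u)) //= eqxx /= (negPf lo) big1 ?addr0 // => k ->.
Qed.

(** The two equations of an admissible decomposition determine its marginals,
    because the coefficients along the flag weights are unique. *)
Lemma admissible_coupling (K : fieldType) (V : finType) (E : V -> vectType K)
    (o : forall i, 'I_(\dim {:E i})) (u v : V)
    (lam : one_ps (E u)) (lam' : one_ps (E v)) (f : 'Hom(E u, E v)) eta :
  o u = 0%N :> nat -> o v = 0%N :> nat ->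
  admissible_decomposition lam lam' f eta ->
  coupling (T := fun i => 'I_(\dim {:E i})) o
    (jump (ops_ratwt lam)) (jump (ops_ratwt lam')) eta.
Proof.
move=> ou ov [eta_ge0 lamE lamE' _]; split=> // [k ko|l lo].
  rewrite lamE; under [in RHS]eq_bigr => i _ do rewrite -scaler_suml.
  by rewrite jump_gam_sum // lt0n -ou.
rewrite lamE' exchange_big /=.
under [in RHS]eq_bigr => i _ do rewrite -scaler_suml.
by rewrite jump_gam_sum // lt0n -ov.
Qed.

Theorem theorem3p7 (R : realType) (n : nat) (Q : quiver 'I_n)
  (Q_tree : oriented_tree Q)
  (E : 'I_n -> vectType R[i])
  (dim_gt0 : forall i, (0 < \dim {:E i})%N)
  (f : forall a : Q, 'Hom(E (qtail a), E (qhead a)))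
  (f_neq0 : forall a, f a != 0)
  (lam : forall i, one_ps (E i))
  (eta0 : forall a : Q,
     'I_(\dim {:E (qtail a)}) -> 'I_(\dim {:E (qhead a)}) -> rat)
  (eta0_adm : forall a : Q, active_arrow lam a ->
     admissible_decomposition (lam (qtail a)) (lam (qhead a)) (f a) (eta0 a)) :
  exists eta : {dffun forall i : 'I_n, 'I_(\dim {:E i})} -> rat,
    [/\ forall j, 0 <= eta j,
        forall i, ops_ratwt (lam i)
          = \sum_(j : {dffun forall i : 'I_n, 'I_(\dim {:E i})})
              eta j *: gam (\dim {:E i}) (j i),
        forall j, eta j != 0 ->
          basic (fun i => ops_basis (lam i)) f (fun i => j i) &
        (* The pair (0,0) is excluded: there both components of the summand
           vanish, so the decompositions do not determine its coefficient. *)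
        forall a : Q, active_arrow lam a ->
          forall (k : 'I_(\dim {:E (qtail a)}))
                 (l : 'I_(\dim {:E (qhead a)})),
            ((k : nat), (l : nat)) != (0%N, 0%N) ->
            \sum_(j : {dffun forall i : 'I_n, 'I_(\dim {:E i})}
                   | (j (qtail a) == k) && (j (qhead a) == l)) eta j
              = eta0 a k l].
Proof.
pose T i : finType := 'I_(\dim {:E i}).
pose o i : T i := Ordinal (dim_gt0 i).
pose c i (k : T i) : rat := jump (ops_ratwt (lam i)) k.
have c_ge0 i (k : T i) : k != o i -> 0 <= c i k.
  by move=> _; rewrite /c /jump !mxE subr_ge0 ler_int ops_sorted //= leq_pred.
have exq (a : Q) : exists q : T (qtail a) -> T (qhead a) -> rat,
    [/\ coupling o (@c (qtail a)) (@c (qhead a)) q,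
        active_arrow lam a -> q = eta0 a &
        forall k l, k != o (qtail a) -> l != o (qhead a) -> q k l != 0 ->
          active_arrow lam a].
  have [act|inact] := pselect (active_arrow lam a).
    exists (eta0 a); split=> //.
    exact: (@admissible_coupling _ _ E o _ _ _ _ _ _ _ _ (eta0_adm a act)).
  eexists; split; first exact: axial_coupling (c_ge0 _) (c_ge0 _).
  - by move=> /inact.
  - by move=> k l ko lo /=; rewrite ko (negPf lo) eqxx.
pose q a := projT1 (cid (exq a)).
have [qP q_act q_supp] :
  [/\ forall a, coupling o (@c (qtail a)) (@c (qhead a)) (q a),
      forall a, active_arrow lam a -> q a = eta0 a &
      forall a k l, k != o (qtail a) -> l != o (qhead a) -> q a k l != 0 ->
        active_arrow lam a].
  by split=> a; rewrite /q; case: cid => ? [].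
have [eta [eta_ge0 eta_conn eta_vertex eta_arrow]] :=
  tree_gluing Q_tree c_ge0 qP.
exists eta; split=> //.
- (* Group the tuples by their index at i, where eta has the right jumps. *)
  move=> i.
  rewrite (partition_big (fun j : {dffun forall i, T i} => j i) xpredT) //=.
  rewrite {1}(@gam_expansion _ (ops_ratwt (lam i))
    (fun k => \sum_(j : {dffun forall i, T i} | j i == k) eta j)).
  + apply: eq_bigr => k _; rewrite scaler_suml.
    by apply: eq_bigr => j /eqP<-.
  + under eq_bigr => k _ do rewrite mxE.
    by rewrite -(rmorph_sum intr) /= ops_sum0.
  + by move=> k k0; rewrite eta_vertex // -val_eqE /= -lt0n.
- move=> j ej.
  have suppE : jsupp E (fun i => j i) = csupp o j.
    by apply/setP => i; rewrite !inE ltn_ord andbT -val_eqE /= -lt0n.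
  split=> [|a]; first by rewrite suppE; apply: eta_conn.
  rewrite suppE !inE => jt jh.
  have qj : q a (j (qtail a)) (j (qhead a)) != 0.
    rewrite -eta_arrow ?jt //; apply: contraNneq ej => /psumr_eq0P-> //.
    by rewrite !eqxx.
  have act := q_supp _ _ _ jt jh qj.
  have [_ _ _ [r [s [_ _ /(_ _ _)]]]] := eta0_adm a act.
  rewrite q_act // in qj; move=> /(_ _ _ qj)[[_ /(_ tt)]] + _.
  apply; rewrite inE /= ltn_ord andbT lt0n; [exact: jt | exact: jh].
- move=> a act k l kl; rewrite -q_act // -eta_arrow //.
  by rewrite -!val_eqE /= -negb_and -xpair_eqE.
Qed.
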